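(* Let $s\in\mathbb{N}$ and let $p_1,\ldots,p_s$ be pairwise different prime numbers, $\boldsymbol{p}=(p_1,\ldots,p_s)$. Let $\omega=(\boldsymbol{x}_n)_{n\in\mathbb{N}_0}$ be the Halton sequence in bases $p_1,\ldots,p_s$, i.e. $\boldsymbol{x}_n=(\phi_{p_1}(n),\ldots,\phi_{p_s}(n))$. Then for every $N\in\mathbb{N}$, $$F_N^2(\omega)\le c(\boldsymbol{p},s)\frac{(\log N)^s}{N^2}+\frac{d(\boldsymbol{p},s)}{N^2},$$ where $$c(\boldsymbol{p},s)=\frac{1}{\sigma_{\boldsymbol{p}}-1}\,\frac{\pi^2}{3}\prod_{j=1}^s\left(1+2\frac{p_j^2}{\log p_j}\right),\qquad d(\boldsymbol{p},s)=2s\max_{1\le i\le s}p_i,$$ and $\sigma_{\boldsymbol{p}}=\prod_{i=1}^s(p_i+1)$.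
   Context: For a prime $p$, the Monna map $\phi_p$ is defined on non-negative integers $n=\sum_{r\ge0}n_rp^r$ (base-$p$ digits $n_r\in\{0,\ldots,p-1\}$) by $\phi_p(n)=\sum_{r\ge 0}n_rp^{-r-1}$; more generally on $p$-adic integers $z=\sum_{r\ge0}z_rp^r$ by $\phi_p(z)=\sum_{r\ge0}z_rp^{-r-1}\pmod 1$. Its inverse $\phi_p^+:[0,1)\to\mathbb{Z}_p$ is $\phi_p^+(\sum_{r\ge0}x_rp^{-r-1})=\sum_{r\ge0}x_rp^r$, always using the finite base-$p$ expansion for $p$-adic rationals. For $k\in\mathbb{N}_0$ the $k$-th $p$-adic function is $\gamma_k(x)=\exp(2\pi i\,\phi_p(k)\,\phi_p^+(x))$ for $x\in[0,1)$ (the product $\phi_p(k)\phi_p^+(x)$ is interpreted via $p$-adic arithmetic: writing $\phi_p(k)=A/p^{a+1}$, it equals $\exp(2\pi i A z/p^{a+1})$ with $z=\phi_p^+(x)$, which is well defined modulo $p^{a+1}$). For $\boldsymbol{p}=(p_1,\ldots,p_s)$ and $\boldsymbol{k}\in\mathbb{N}_0^s$, $\gamma_{\boldsymbol{k}}(\boldsymbol{x})=\prod_{i=1}^s\gamma_{k_i}(x_i)$, with $\gamma_{k_i}$ taken in base $p_i$. Set $\rho_p(0)=1$ and $\rho_p(k)=p^{-2t}$ if $p^t\le k<p^{t+1}$, $t\in\mathbb{N}_0$; $\rho_{\boldsymbol{p}}(\boldsymbol{k})=\prod_{j=1}^s\rho_{p_j}(k_j)$. The $\boldsymbol{p}$-adic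 diaphony of a sequence $\omega=(\boldsymbol{x}_n)_{n\ge0}$ in $[0,1)^s$ is $$F_N(\omega)=\left(\frac{1}{\sigma_{\boldsymbol{p}}-1}\sum_{\boldsymbol{k}\in\mathbb{N}_0^s\setminus\{\boldsymbol{0}\}}\rho_{\boldsymbol{p}}(\boldsymbol{k})\left|\frac1N\sum_{n=0}^{N-1}\gamma_{\boldsymbol{k}}(\boldsymbol{x}_n)\right|^2\right)^{1/2},\quad \sigma_{\boldsymbol{p}}=\prod_{i=1}^s(p_i+1).$$ *)

(* Defs.v *)
From HB Require Import structures.
From mathcomp Require Export all_boot all_order all_algebra.
From mathcomp Require Export all_classical all_reals all_analysis.
From mathcomp Require Export complex.

Set Implicit Arguments.
Unset Strict Implicit.
Unset Printing Implicit Defensive.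

Import Order.TTheory GRing.Theory Num.Theory.
Import numFieldNormedType.Exports.

Local Open Scope ring_scope.

Definition expi (R : realType) (t : R) : R[i] := Complex (cos t) (sin t).

Definition digit (p n r : nat) : nat := ((n %/ p ^ r) %% p)%N.

(* [trunc_log p n] is the position of the leading base-p digit of n (0 if n is
   0), so this is the sum over all digit positions of n. *)
Definition monna (R : realType) (p n : nat) : R :=
  \sum_(r < (trunc_log p n).+1) (digit p n r)%:R / p%:R ^+ r.+1.

(* A p-adic integer sum_r z_r p^r is represented by its digit sequence z. *)
Definition padic_digits : Type := nat -> nat.

(* The residue of z modulo p^m. *)
Definition padic_trunc (p : nat) (z : padic_digits) (m : nat) : nat :=
  (\sum_(r < m) z r * p ^ r)%N.

(* Meant for x in [0,1[.  The r-th base-p digit x_r of x = sum_r x_r p^(-r-1)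
   is floor (x p^(r+1)) mod p; p-adic rationals get their finite expansion. *)
Definition monna_inv (R : realType) (p : nat) (x : R) : padic_digits :=
  fun r => (Num.truncn (x * p%:R ^+ r.+1) %% p)%N.

(* For a = trunc_log p k, [monna R p k] is of the form A / p^(a+1) with A an
   integer, so its product with the p-adic integer [monna_inv p x] is
   determined modulo 1 by the residue of the latter modulo p^(a+1). *)
Definition padic_fun (R : realType) (p k : nat) (x : R) : R[i] :=
  expi (2 * pi *
    (monna R p k * (padic_trunc p (monna_inv p x) (trunc_log p k).+1)%:R)).

Definition padic_fun_vec (R : realType) (s : nat) (p : 'I_s -> nat)
    (k : {ffun 'I_s -> nat}) (x : 'I_s -> R) : R[i] :=
  \prod_(i < s) padic_fun (p i) (k i) (x i).

Definition rho (R : realType) (p k : nat) : R :=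
  if k == 0%N then 1 else p%:R ^- (2 * trunc_log p k).

Definition rho_vec (R : realType) (s : nat) (p : 'I_s -> nat)
    (k : {ffun 'I_s -> nat}) : R :=
  \prod_(j < s) rho R (p j) (k j).

Definition sigma (R : realType) (s : nat) (p : 'I_s -> nat) : R :=
  \prod_(i < s) ((p i)%:R + 1).

(* Extended-real valued: no convergence of the series is presupposed. *)
Definition diaphony (R : realType) (s : nat) (p : 'I_s -> nat)
    (omega : nat -> 'I_s -> R) (N : nat) : \bar R :=
  sqrte ((sigma R p - 1)^-1%:E *
    \esum_(k in [set k : {ffun 'I_s -> nat} | k != [ffun=> 0%N]])
      (rho_vec R p k *
       Normc.normc (N%:R^-1 *
         \sum_(0 <= n < N) padic_fun_vec p k (omega n)) ^+ 2)%:E)%E.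

Definition halton (R : realType) (s : nat) (p : 'I_s -> nat) :
    nat -> 'I_s -> R :=
  fun n i => monna R (p i) n.

Definition c_const (R : realType) (s : nat) (p : 'I_s -> nat) : R :=
  (sigma R p - 1)^-1 * (pi ^+ 2 / 3) *
  \prod_(j < s) (1 + 2 * ((p j)%:R ^+ 2 / ln (p j)%:R)).

Definition d_const (R : realType) (s : nat) (p : 'I_s -> nat) : R :=
  (2 * s * \max_(i < s) p i)%N%:R.

(* Main.v *)
(* On the Halton sequence, phi_p^+ undoes the Monna map, so each exponential
   sum is geometric: S_N(k) = sum_(n<N) z_k^n with
   z_k = exp (2 pi i sum_i phi_(p_i)(k_i)).  Over a box k_i < p_i^(l_i), with
   P = prod_i p_i^(l_i), coprimality of the bases gives the orthogonality
   relation sum_k z_k^d = P if P divides d and 0 otherwise; hence Parseval's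
   identity sum_k |S_r(k)|^2 = P r for r <= P.  For r = P the term k = 0 already
   accounts for the whole sum, so S_P(k) = 0 for k != 0, whence
   S_N(k) = S_(N mod P)(k) and sum_(k != 0) |S_N(k)|^2 <= P^2 for every N.
   Weighting the boxes by rho, the indices with k_i < p_i^(g_i) for all i
   contribute at most N^(-2) prod_i (1 + g_i p_i^2), and the others at most
   sigma sum_i p_i^(1 - g_i) / (p_i + 1) by the trivial bound.  Take g_i maximal
   with p_i^(g_i) <= N^2. *)
Require Import Defs.
From mathcomp Require Import ring lra zify.
Import Order.TTheory GRing.Theory Num.Theory.

Set Implicit Arguments.
Unset Strict Implicit.
Unset Printing Implicit Defensive.

Local Open Scope ring_scope.

(** * The character exp(2 pi i t) *)

Definition echar (R : realType) (t : R) : R[i] := expi (2 * pi * t).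

Lemma echarD (R : realType) (x y : R) : echar (x + y) = echar x * echar y.
Proof.
by rewrite /echar /expi mulrDr cosD sinD; congr Complex; rewrite addrC mulrC.
Qed.

Lemma echar0 (R : realType) : echar (0 : R) = 1.
Proof. by rewrite /echar mulr0 /expi cos0 sin0. Qed.

Lemma echarX (R : realType) (x : R) (n : nat) :
  echar (x * n%:R) = echar x ^+ n.
Proof.
elim: n => [|n IHn]; first by rewrite mulr0 echar0.
by rewrite -natr1 mulrDr mulr1 echarD IHn exprSr.
Qed.

Lemma echar_nat (R : realType) (n : nat) : echar (n%:R : R) = 1.
Proof.
rewrite -[n%:R]mul1r echarX /echar /expi mulr1 mulr_natl cos2pi sin2pi.
exact: expr1n.
Qed.

(** The real part is 1 - 2 sin(pi t)^2, and the sine is positive because 0 < pi t < pi. *)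
Lemma echar_neq1 (R : realType) (t : R) : 0 < t < 1 -> echar t != 1.
Proof.
move=> /andP[t0 t1]; apply/eqP => /(congr1 (@complex.Re R)) /= cos1.
have /eqP : cos (2 * pi * t) = 1 - 2 * sin (pi * t) ^+ 2.
  rewrite -mulrA mulr_natl mulr2n cosD -!expr2 cos2sin2; ring.
rewrite cos1 eq_sym subr_eq addrC -subr_eq subrr eq_sym mulf_eq0 pnatr_eq0 /=.
rewrite expf_eq0 /= gt_eqF // sin_gt0_pi // mulr_gt0 ?pi_gt0 //=.
by rewrite -[ltRHS]mulr1 ltr_pM2l ?pi_gt0.
Qed.

Lemma normc_echar (R : realType) (t : R) : Normc.normc (echar t) = 1.
Proof. by rewrite /= cos2Dsin2 sqrtr1. Qed.

(** * Digits, the Monna map and its inverse *)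

Lemma digit_eq0 (p n r : nat) : (n < p ^ r)%N -> digit p n r = 0%N.
Proof. by move=> ltn; rewrite /digit divn_small // mod0n. Qed.

(** Digits beyond the leading one vanish. The recursion below needs compatible summation ranges for
    [n] and [n %/ p]. *)
Lemma monna_widen (R : realType) (p n m : nat) : (1 < p)%N -> (n <= m)%N ->
  monna R p n = \sum_(r < m.+1) (digit p n r)%:R / p%:R ^+ r.+1.
Proof.
move=> p1 nm; have lem : (trunc_log p n <= m)%N.
  case: (posnP n) => [->|n0]; first by rewrite trunc_log0.
  rewrite (leq_trans _ nm) // ltnW //.
  by rewrite (leq_trans (ltn_expl _ p1)) // trunc_logP.
rewrite /monna (big_ord_widen m.+1
  (fun r => (digit p n r)%:R / p%:R ^+ r.+1 : R)) // big_mkcond /=.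
apply: eq_bigr => r _; case: ltnP => // lt_r; rewrite digit_eq0 ?mul0r //.
by rewrite (leq_trans (trunc_log_ltn n p1)) // leq_exp2l.
Qed.

Lemma monna0 (R : realType) (p : nat) : monna R p 0 = 0.
Proof. by rewrite /monna big1 // => r _; rewrite /digit div0n mod0n mul0r. Qed.

Lemma monna_rec (R : realType) (p n : nat) : (1 < p)%N ->
  monna R p n = ((n %% p)%:R + monna R p (n %/ p)) / p%:R.
Proof.
move=> p1; rewrite (@monna_widen R p n n.+1) // big_ord_recl /=.
rewrite (@monna_widen R p (n %/ p) n) ?leq_div // mulrDl expr1.
congr (_ + _); first by rewrite /digit expn0 divn1.
rewrite mulr_suml; apply: eq_bigr => r _.
by rewrite /bump /= add1n /digit expnS divnMA exprS invfM [_^-1 * _]mulrC mulrA.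
Qed.

Lemma monna_muladd (R : realType) (p c k : nat) : (1 < p)%N -> (c < p)%N ->
  monna R p (k * p + c) = (c%:R + monna R p k) / p%:R.
Proof.
move=> p1 cp; rewrite monna_rec // modnMDl modn_small //.
by rewrite divnMDl 1?ltnW // divn_small // addn0.
Qed.

Lemma monna_itv (R : realType) (p n : nat) : (1 < p)%N -> 0 <= monna R p n < 1.
Proof.
move=> p1; elim/ltn_ind: n => n IHn.
have p0 : 0 < p%:R :> R by rewrite ltr0n ltnW.
case: (posnP n) => [->|n0]; first by rewrite monna0 lexx ltr01.
rewrite monna_rec //; have /andP[m0 m1] := IHn _ (ltn_Pdiv p1 n0).
rewrite divr_ge0 ?addr_ge0 // 1?ltW // ltr_pdivrMr // mul1r.
have : (n %% p).+1%:R <= p%:R :> R by rewrite ler_nat ltn_pmod // ltnW.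
by rewrite -natr1; lra.
Qed.

(** Induction on [l]: passing from [k] to [k %/ p] removes one digit. Integrality makes exp(2 pi i n
    phi_p(k)) periodic in n modulo p^l. *)
Lemma monna_exp_nat (R : realType) (p l k : nat) : (1 < p)%N ->
  (k < p ^ l)%N -> monna R p k * (p ^ l)%:R \is a Num.nat.
Proof.
move=> p1; have p0 : p%:R != 0 :> R by rewrite pnatr_eq0 -lt0n ltnW.
elim: l k => [|l IHl] k.
  by rewrite expn0 ltnS leqn0 => /eqP->; rewrite monna0 mul0r.
rewrite expnSr => kl; rewrite monna_rec // natrM mulrA [_ * p%:R]mulrC.
rewrite [X in X \is a _](_ : _ =
  (k %% p * p ^ l)%N%:R + monna R p (k %/ p) * (p ^ l)%:R); last first.
  by rewrite natrM; field.
by rewrite rpredD ?natr_nat ?IHl ?ltn_divLR // ltnW.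
Qed.

Lemma monna_inv_monna (R : realType) (p n r : nat) : (1 < p)%N ->
  monna_inv p (monna R p n) r = digit p n r.
Proof.
move=> p1; have p0 : p%:R != 0 :> R by rewrite pnatr_eq0 -lt0n ltnW.
elim: r n => [|r IHr] n; rewrite /monna_inv monna_rec // exprS mulrA divfK //.
  rewrite expr0 mulr1 /digit expn0 divn1.
  have /andP[m0 m1] := monna_itv R (n %/ p) p1.
  rewrite (@Num.Theory.truncn_def _ _ (n %% p)) ?modn_mod //.
  by rewrite -natr1 lerDl m0 ltrD2l.
(* The lowest digit contributes an integer multiple of p, which is invisible modulo p after
   truncation. *)
rewrite mulrDl -natrX -natrM Num.Theory.truncnD ?natr_nat //; last first.
  by rewrite nnegrE mulr_ge0 //; case/andP: (monna_itv R (n %/ p) p1).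
rewrite Num.Theory.natrK natrX expnSr mulnA modnMDl.
have := IHr (n %/ p)%N; rewrite /monna_inv => ->.
by rewrite /digit expnS divnMA.
Qed.

Lemma padic_trunc_monna (R : realType) (p n m : nat) : (1 < p)%N ->
  padic_trunc p (monna_inv p (monna R p n)) m = (n %% p ^ m)%N.
Proof.
move=> p1; rewrite /padic_trunc.
under eq_bigr => r _ do rewrite monna_inv_monna //.
elim: m => [|m IHm]; first by rewrite big_ord0 expn0 modn1.
rewrite big_ord_recr /= IHm /digit expnSr.
have pm0 : (0 < p ^ m)%N by rewrite expn_gt0 ltnW.
set q := (p ^ m)%N in pm0 *.
have nE : (n = n %/ q %/ p * (q * p) + (n %/ q %% p * q + n %% q))%N.
  rewrite {1}(divn_eq n q) {1}(divn_eq (n %/ q) p) mulnDl.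
  by rewrite -mulnA [(p * q)%N]mulnC addnA.
rewrite {3}nE modnMDl addnC [RHS]modn_small //.
rewrite (@leq_trans (((n %/ q) %% p).+1 * q)) //.
  by rewrite mulSn addnC ltn_add2r ltn_mod.
by rewrite mulnC leq_mul2l ltn_mod [(0 < p)%N]ltnW // orbT.
Qed.

(** The residue of n modulo p^m may be replaced by n itself: they differ by a multiple of p^m, and
    phi_p(k) p^m is an integer. *)
Lemma padic_fun_monna (R : realType) (p k n : nat) : (1 < p)%N ->
  padic_fun p k (monna R p n) = echar (monna R p k) ^+ n.
Proof.
move=> p1; rewrite /padic_fun padic_trunc_monna // -/(echar _) -echarX.
set m := (trunc_log p k).+1.
have [a ma] := natrP (monna_exp_nat R p1 (trunc_log_ltn k p1)).
rewrite [in RHS](divn_eq n (p ^ m)) natrD natrM mulrDr mulrCA ma -natrM.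
by rewrite echarD echar_nat mul1r.
Qed.

(** * Orthogonality relations in one base *)

(** If p does not divide d, then z is a p-th root of unity other than 1, and (z - 1) times the sum
    is z^p - 1 = 0. *)
Lemma sum_echar_root (R : realType) (p d : nat) : (0 < p)%N ->
  \sum_(c < p) echar (c%:R / p%:R * d%:R : R) = if (p %| d)%N then p%:R else 0.
Proof.
move=> p0; have p0' : p%:R != 0 :> R by rewrite pnatr_eq0 -lt0n.
pose z := echar (d%:R / p%:R : R).
rewrite (eq_bigr (fun c : 'I_p => z ^+ c)); last first.
  by move=> c _; rewrite /z -echarX; congr echar; field.
have zp : z ^+ p = 1 by rewrite /z -echarX divfK // echar_nat.
have zmod : z = echar ((d %% p)%N%:R / p%:R).
  rewrite /z {1}(divn_eq d p) natrD natrM mulrDl mulfK // echarD.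
  by rewrite echar_nat mul1r.
case: ifP => [/eqP d0|/negbT dNp].
  rewrite (eq_bigr (fun=> 1)) ?sumr_const ?card_ord // => c _.
  by rewrite zmod d0 mul0r echar0 expr1n.
have z1 : z != 1.
  have dp0 : (0 < d %% p)%N by rewrite lt0n.
  rewrite zmod echar_neq1 // divr_gt0 ?ltr0n //=.
  by rewrite ltr_pdivrMr ?ltr0n // mul1r ltr_nat ltn_mod.
apply/eqP; have /eqP := subrX1 z p.
by rewrite zp subrr eq_sym mulf_eq0 subr_eq0 (negPf z1).
Qed.

(** Induction on [l], writing k = i p + c. The sum over the lowest digit c factors out and vanishes
    unless d = q p; what remains is the sum for [l] digits and exponent q. *)
Lemma sum_echar_monna (R : realType) (p l d : nat) : (1 < p)%N ->
  \sum_(k < p ^ l) echar (monna R p k) ^+ d =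
  if (p ^ l %| d)%N then (p ^ l)%:R else 0.
Proof.
move=> p1; have p0 : (0 < p)%N by rewrite ltnW.
have p0' : p%:R != 0 :> R by rewrite pnatr_eq0 -lt0n.
elim: l d => [|l IHl] d.
  by rewrite expn0 big_ord_recl big_ord0 monna0 echar0 expr1n dvd1n addr0.
rewrite -(big_mkord xpredT (fun k => echar (monna R p k) ^+ d)) expnSr.
rewrite big_nat_mul big_mkord.
have -> : \sum_(i < p ^ l)
      \sum_(i * p <= j < i.+1 * p) echar (monna R p j) ^+ d =
    (\sum_(c < p) echar (c%:R / p%:R * d%:R : R)) *
    \sum_(i < p ^ l) echar (monna R p i / p%:R * d%:R).
  rewrite mulr_sumr; apply: eq_bigr => i _; rewrite mulr_suml.
  rewrite -{1}[(i * p)%N]add0n mulSn big_addn addnK big_mkord.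
  apply: eq_bigr => c _; rewrite addnC monna_muladd // -echarX -echarD.
  by rewrite !mulrDl.
rewrite sum_echar_root //; case: ifP => [/dvdnP[q ->]|dNp].
  rewrite dvdn_pmul2r //.
  rewrite (eq_bigr (fun i : 'I__ => echar (monna R p i) ^+ q)); last first.
    by move=> i _; rewrite natrM -echarX; congr echar; field.
  by rewrite IHl mulnC natrM; case: ifP; rewrite ?mulr0.
rewrite mul0r; case: ifP => // /(dvdn_trans (dvdn_mull _ (dvdnn p))).
by rewrite dNp.
Qed.

(** * Parseval's identity for geometric sums *)

(** P - 1 plays the role of -1 modulo P, so the left side tests whether P divides n - m while
    exponents stay natural. *)
Lemma dvdn_add_predM (P n m : nat) : (n < P)%N -> (m < P)%N ->
  (P %| n + m * P.-1)%N = (n == m).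
Proof.
move=> nP mP; have -> : (n == m) = (n == m %[mod P])%N by rewrite !modn_small.
have P0 : (0 < P)%N by apply: leq_trans nP.
rewrite -[in RHS](modnMDl m n P) eqn_mod_dvd; last by nia.
by congr (_ %| _)%N; nia.
Qed.

(** The conjugate of z^m is z^(m (P - 1)) for a P-th root of unity. After expanding the square and
    exchanging sums, only the r diagonal pairs n = m survive, each giving P. *)
Lemma sum_sqr_norm_geometric (C : numClosedFieldType) (I : finType)
    (A : pred I) (z : I -> C) (P r : nat) :
  (forall k, A k -> z k ^+ P = 1) ->
  (forall d, \sum_(k | A k) z k ^+ d = if (P %| d)%N then P%:R else 0) ->
  (r <= P)%N ->
  \sum_(k | A k) `|\sum_(n < r) z k ^+ n| ^+ 2 = (P * r)%:R.
Proof.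
move=> zP sumz rP.
have conj_z k m : A k -> (0 < P)%N -> (z k ^+ m)^* = z k ^+ (m * P.-1).
  move=> Ak P0; have zk0 : z k != 0.
    apply/negP => /eqP z0; have := zP k Ak.
    by rewrite z0 expr0n eqn0Ngt P0 => /eqP; rewrite eq_sym oner_eq0.
  have norm1 : `|z k| = 1.
    by apply/eqP; rewrite -(@pexpr_eq1 _ _ P) // -normrX zP // normr1.
  rewrite mulnC exprM rmorphXn /=; congr (_ ^+ _).
  apply: (mulfI zk0); rewrite -normCK norm1 expr1n -exprS prednK //.
  by rewrite zP.
rewrite (eq_bigr (fun k => \sum_(n < r) \sum_(m < r) z k ^+ (n + m * P.-1))).
  rewrite exchange_big /= (eq_bigr (fun=> P%:R)).
    by rewrite sumr_const card_ord mulrnA.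
  move=> n _; rewrite exchange_big /= (bigD1 n) //= sumz.
  rewrite dvdn_add_predM ?(leq_trans _ rP) // eqxx big1 ?addr0 // => m mn.
  rewrite sumz dvdn_add_predM ?(leq_trans _ rP) // eq_sym.
  by rewrite (negPf (mn : m != n :> nat)).
move=> k Ak; rewrite normCK rmorph_sum big_distrlr /=.
apply: eq_bigr => n _; apply: eq_bigr => m _.
by rewrite conj_z // ?exprD // (leq_trans _ rP) // (leq_trans _ (ltn_ord n)).
Qed.

Lemma sum_sqr_norm_geometric_le (C : numClosedFieldType) (I : finType)
    (A : pred I) (z : I -> C) (k0 : I) (P N : nat) :
  (0 < P)%N -> A k0 -> z k0 = 1 ->
  (forall k, A k -> z k ^+ P = 1) ->
  (forall d, \sum_(k | A k) z k ^+ d = if (P %| d)%N then P%:R else 0) ->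
  \sum_(k | A k && (k != k0)) `|\sum_(n < N) z k ^+ n| ^+ 2 <= P%:R ^+ 2.
Proof.
move=> P0 Ak0 zk0 zP sumz.
have sumP0 k : A k && (k != k0) -> `|\sum_(n < P) z k ^+ n| ^+ 2 = 0.
  move: k; apply: psumr_eq0P => [k _|]; first exact: exprn_ge0.
  have := sum_sqr_norm_geometric zP sumz (leqnn P).
  rewrite (bigD1 k0) //= zk0 (eq_bigr (fun=> 1)) => [|n _]; last exact: expr1n.
  rewrite sumr_const card_ord normr_nat -natrX -[RHS]addr0.
  by rewrite mulnn => /addrI.
pose r := (N %% P)%N.
have sumNr k : A k && (k != k0) ->
    \sum_(n < N) z k ^+ n = \sum_(n < r) z k ^+ n.
  move=> Ak; have z1 : z k - 1 != 0.
    rewrite subr_eq0; apply/negP => /eqP zk1; have := sumP0 k Ak.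
    rewrite zk1 (eq_bigr (fun=> 1)) => [|n _]; last exact: expr1n.
    rewrite sumr_const card_ord normr_nat => /eqP.
    by rewrite expf_eq0 /= pnatr_eq0 eqn0Ngt P0.
  (* Multiplied by z - 1, the two sums become z^N - 1 and z^r - 1, which agree because z^P = 1. *)
  apply: (mulfI z1); rewrite -!subrX1 /r; case/andP: Ak => Ak _.
  by rewrite expr_mod // zP.
rewrite (eq_bigr (fun k => `|\sum_(n < r) z k ^+ n| ^+ 2)); last first.
  by move=> k Ak; rewrite sumNr.
have rP : (r <= P)%N by rewrite ltnW // ltn_mod.
apply: (@le_trans _ _ (P * r)%:R).
  rewrite -(sum_sqr_norm_geometric zP sumz rP) [leRHS](bigD1 k0) //= lerDr.
  exact: exprn_ge0.
by rewrite -natrX ler_nat -mulnn leq_mul2l rP orbT.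
Qed.

(** * Boxes of indices in several bases *)

(** Boxes of all shapes [l] live in one finite type, so that sums over different boxes can be
    combined; [M] only has to be at least every side p_i^(l_i). *)
Definition box (s M : nat) (p l : 'I_s -> nat) : pred {ffun 'I_s -> 'I_M} :=
  [pred k | k \in family (fun i (j : 'I_M) => (j < p i ^ l i)%N)].

(** The number z_k whose n-th power is the value of the k-th p-adic function at the n-th Halton
    point. *)
Definition echar_vec (R : realType) (s M : nat) (p : 'I_s -> nat)
    (k : {ffun 'I_s -> 'I_M}) : R[i] :=
  \prod_(i < s) echar (monna R (p i) (k i)).

Arguments echar_vec R {s M} p k.

(** The sum factors over the coordinates, and the pairwise coprime p_i^(l_i) all divide d exactly
    when their product does. *)
Lemma sum_echar_box (R : realType) (s M : nat) (p l : 'I_s -> nat) (d : nat) :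
  (forall i, prime (p i)) -> injective p -> (forall i, p i ^ l i <= M)%N ->
  \sum_(k : {ffun 'I_s -> 'I_M} | box p l k) echar_vec R p k ^+ d =
  if (\prod_i p i ^ l i %| d)%N then (\prod_i p i ^ l i)%N%:R else 0.
Proof.
move=> p_prime p_inj lM; rewrite /box /=.
under eq_bigr => k _ do rewrite /echar_vec -prodrXl.
rewrite -(@bigA_distr_big_dep _ _ _ _ _ _ _
  (fun i (j : 'I_M) => (j < p i ^ l i)%N)
  (fun i (j : 'I_M) => echar (monna R (p i) j) ^+ d)).
rewrite (eq_bigr (fun i => if (p i ^ l i %| d)%N then (p i ^ l i)%:R else 0)).
  case: (@unstable.Gauss_dvd_prod _ (index_enum 'I_s) xpredT
    (fun i => p i ^ l i)%N d) => [|dvd|ndvd].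
  - rewrite filter_predT pairwise_map.
    apply: (@sub_in_pairwise _ predT (fun i j => i != j)); last 2 first.
    + by apply/allP.
    + by rewrite -uniq_pairwise index_enum_uniq.
    move=> i j _ _ /= ij; apply/coprimeXl/coprimeXr.
    by rewrite prime_coprime // dvdn_prime2 // (inj_eq p_inj).
  - rewrite natr_prod; apply: eq_bigr => i _.
    by rewrite dvd // mem_index_enum.
  - have [i /negPf dNi] : exists i, ~~ (p i ^ l i %| d)%N.
      apply/existsP; rewrite -negb_forall; apply/negP => /forallP dvd.
      by apply: ndvd => i _ _.
    by rewrite (bigD1 i) //= dNi mul0r.
move=> i _; rewrite -sum_echar_monna ?prime_gt1 //.
by rewrite (big_ord_widen M (fun k => echar (monna R (p i) k) ^+ d)).
Qed.

Lemma sum_box_le (R : realType) (s M : nat) (p l : 'I_s -> nat) (N : nat) :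
  (forall i, prime (p i)) -> injective p -> (forall i, p i ^ l i <= M.+1)%N ->
  \sum_(k : {ffun 'I_s -> 'I_M.+1} | box p l k && (k != [ffun=> ord0]))
    Normc.normc (\sum_(n < N) echar_vec R p k ^+ n) ^+ 2 <=
  (\prod_i p i ^ l i)%N%:R ^+ 2.
Proof.
(* Embedding the real inequality into [R[i]] turns [Normc.normc] into the norm of a closed field,
   where Parseval's identity is available. *)
move=> p_prime p_inj lM; rewrite -lecR rmorph_sum /= -natrX rmorph_nat natrX.
rewrite (eq_bigr (fun k => `|\sum_(n < N) echar_vec R p k ^+ n| ^+ 2)) => [|k _].
  apply: sum_sqr_norm_geometric_le.
  - by rewrite prodn_gt0 // => i; rewrite expn_gt0 prime_gt0.
  - by apply/familyP => i; rewrite ffunE unfold_in /= expn_gt0 prime_gt0.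
  - by rewrite /echar_vec big1 // => i _; rewrite ffunE monna0 echar0.
  - move=> k /familyP kbox; rewrite /echar_vec -prodrXl big1 // => i _.
    have [a kla] := natrP (monna_exp_nat R (prime_gt1 (p_prime i)) (kbox i)).
    rewrite (bigD1 i) //= exprM -[_ ^+ (p i ^ l i)]echarX kla echar_nat.
    exact: expr1n.
  - by move=> d; apply: sum_echar_box.
by rewrite rmorphXn.
Qed.

(** * Weights and weighted sums over a box *)

Lemma rho_ge0 (R : realType) (p k : nat) : 0 <= rho R p k.
Proof. by rewrite /rho; case: ifP => // _; rewrite invr_ge0 exprn_ge0. Qed.

(** Telescoping: the (p - 1) p^t indices with p^t <= k < p^(t+1) have total weight (p - 1) / p^t = p
    / p^t - p / p^(t+1). *)
Lemma sum_rho (R : realType) (p g h : nat) : (1 < p)%N ->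
  \sum_(p ^ g <= k < p ^ (g + h)) rho R p k =
  p%:R / p%:R ^+ g - p%:R / p%:R ^+ (g + h).
Proof.
move=> p1; have p0 : p%:R != 0 :> R by rewrite pnatr_eq0 -lt0n ltnW.
elim: h => [|h IHh]; first by rewrite addn0 subrr big_geq.
rewrite (@big_cat_nat _ _ _ (p ^ (g + h))) /=; last 2 first.
- by rewrite leq_exp2l // leq_addr.
- by rewrite leq_exp2l // addnS.
rewrite IHh addnS; move: (g + h)%N => t {IHh}.
rewrite (@eq_big_nat _ _ _ _ _ _ (fun=> p%:R ^- (2 * t))); last first.
  move=> k tk; rewrite /rho (trunc_log_eq p1 tk) ifF //.
  by case/andP: tk; case: k => //; rewrite leqn0 expn_eq0 eqn0Ngt ltnW.
rewrite sumr_const_nat expnS -{2}(mul1n (p ^ t)%N) -mulnBl.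
rewrite -[_ *+ (_ * _)]mulr_natl natrM natrB 1?ltnW // natrX exprS mulnC exprM.
by field; rewrite !expf_neq0 ?p0.
Qed.

Lemma sum_rho_ge (R : realType) (p g M : nat) : (1 < p)%N ->
  \sum_(k < M | (p ^ g <= k)%N) rho R p k <= p%:R / p%:R ^+ g.
Proof.
move=> p1; have Mle : (M <= p ^ (g + M))%N.
  by rewrite (leq_trans (ltnW (ltn_expl M p1))) // leq_exp2l // leq_addl.
rewrite -(big_mkord (fun k => p ^ g <= k)%N (rho R p)).
rewrite (@le_trans _ _ (\sum_(p ^ g <= k < p ^ (g + M)) rho R p k)) //.
  rewrite [leRHS](@big_nat_widenl _ _ _ _ 0) //=.
  rewrite (big_nat_widen _ _ _ _ _ Mle) [leLHS]big_mkcond [leRHS]big_mkcond /=.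
  apply: ler_sum => k _; case: (p ^ g <= k)%N => //=.
  by case: ifP => // _; exact: rho_ge0.
rewrite sum_rho // gerDl oppr_le0 divr_ge0 // exprn_ge0 //.
Qed.

(** The index 0 has weight 1, and the positive indices form the tail [g = 0], of weight at most
    p. *)
Lemma sum_rho_le (R : realType) (p M : nat) : (1 < p)%N ->
  \sum_(k < M) rho R p k <= p%:R + 1.
Proof.
move=> p1; case: M => [|M]; first by rewrite big_ord0 addr_ge0.
have := sum_rho_ge R 0 M.+1 p1; rewrite !big_mkcond !big_ord_recl /=.
rewrite expr0 divr1 add0r => le_p.
by rewrite addrC lerD.
Qed.

(* The diaphony weight of the integers having exactly [l] base-p digits. *)
Definition level_weight (R : realType) (p l : nat) : R :=
  if l is t.+1 then p%:R ^- (2 * t) else 1.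

Lemma level_weight_ge0 (R : realType) (p l : nat) : 0 <= level_weight R p l.
Proof. by case: l => //= t; rewrite invr_ge0 exprn_ge0. Qed.

(** The term for the exact number of digits of k already equals the weight ([l = 0] when k = 0); the
    other terms are nonnegative. *)
Lemma rho_le_sum_level (R : realType) (p g k : nat) :
  (1 < p)%N -> (k < p ^ g)%N ->
  rho R p k <= \sum_(l < g.+1) level_weight R p l * (k < p ^ l)%N%:R.
Proof.
move=> p1 kg; have ge0 (l : nat) : 0 <= level_weight R p l * (k < p ^ l)%N%:R.
  by rewrite mulr_ge0 // level_weight_ge0.
have [-> | k0] := posnP k.
  by rewrite big_ord_recl /= mulr1 lerDl sumr_ge0.
have tg : (trunc_log p k < g)%N.
  by rewrite -(ltn_exp2l _ _ p1) (leq_ltn_trans (trunc_logP p1 k0)).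
rewrite (bigD1 (Ordinal (tg : ((trunc_log p k).+1 < g.+1)%N))) //=.
rewrite trunc_log_ltn // mulr1 /rho gtn_eqF //.
by rewrite lerDl sumr_ge0.
Qed.

(** For l >= 1 the weight p^(-2(l-1)) turns the squared side p^(2l) into p^2, so every level costs
    the same. *)
Lemma sum_level_weight (R : realType) (p g : nat) : (0 < p)%N ->
  \sum_(l < g.+1) level_weight R p l * (p ^ l)%:R ^+ 2 =
  1 + g%:R * p%:R ^+ 2.
Proof.
move=> p0; have p0' : p%:R != 0 :> R by rewrite pnatr_eq0 -lt0n.
rewrite big_ord_recl /= mul1r expr1n; congr (_ + _).
rewrite (eq_bigr (fun=> p%:R ^+ 2)) => [|l _].
  by rewrite sumr_const card_ord mulr_natl.
rewrite /bump /= add1n natrX -exprM [(_ * 2)%N]mulnC mulnS exprD mulrC.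
by rewrite mulfK ?expf_neq0.
Qed.

(* The factor [k_i < p_i^{g_i}] of the box indicator is dominated by summing
   over all digit lengths, which expands into a sum over smaller boxes. *)
Lemma sum_box_weighted (R : realType) (s M : nat) (p g : 'I_s -> nat)
    (A : pred {ffun 'I_s -> 'I_M}) (a : {ffun 'I_s -> 'I_M} -> R) :
  (forall i, 1 < p i)%N -> (forall k, 0 <= a k) ->
  (forall l : 'I_s -> nat, (forall i, l i <= g i)%N ->
    \sum_(k : {ffun 'I_s -> 'I_M} | box p l k && A k) a k <=
    (\prod_i p i ^ l i)%N%:R ^+ 2) ->
  \sum_(k : {ffun 'I_s -> 'I_M} | box p g k && A k)
    (\prod_i rho R (p i) (k i)) * a k <=
  \prod_i (1 + (g i)%:R * (p i)%:R ^+ 2).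
Proof.
move=> p1 a0 a_le; pose G := (\max_i g i).+1.
have gG i : ((g i).+1 <= G)%N by rewrite ltnS leq_bigmax.
have rho_le (k : {ffun 'I_s -> 'I_M}) : box p g k ->
  \prod_i rho R (p i) (k i) <=
  \sum_(l in family (fun i (j : 'I_G) => (j < (g i).+1)%N))
    \prod_i (level_weight R (p i) (l i) * (k i < p i ^ l i)%N%:R).
  move=> /familyP kg; rewrite -(@bigA_distr_big_dep _ _ _ _ _ _ _
    (fun i (j : 'I_G) => (j < (g i).+1)%N)
    (fun i (j : 'I_G) => level_weight R (p i) j * (k i < p i ^ j)%N%:R)).
  apply: ler_prod => i _; rewrite rho_ge0 /=.
  rewrite -(big_ord_widen G
    (fun j => level_weight R (p i) j * (k i < p i ^ j)%N%:R)) //.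
  by apply: rho_le_sum_level => //; apply: kg.
have prod_ind (k : {ffun 'I_s -> 'I_M}) (l : {ffun 'I_s -> 'I_G}) :
    \prod_i (k i < p i ^ l i)%N%:R = (box p (fun i => l i) k)%:R :> R.
  case: (boolP (box p (fun i => l i) k)) => [/familyP kl|kl].
    by rewrite big1 // => i _; have := kl i; rewrite unfold_in => ->.
  have [i kli] : exists i, ~~ (k i < p i ^ l i)%N.
    apply/existsP; rewrite -negb_forall; apply: contra kl => /forallP kl.
    by apply/familyP => i; exact: kl.
  by rewrite (bigD1 i) //= (negPf kli) mul0r.
apply: (@le_trans _ _ (\sum_(k : {ffun 'I_s -> 'I_M} | A k)
  \sum_(l in family (fun i (j : 'I_G) => (j < (g i).+1)%N))
    (\prod_i level_weight R (p i) (l i)) * ((box p (fun i => l i) k)%:R * a k))).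
  rewrite [leLHS]big_mkcond [leRHS]big_mkcond; apply: ler_sum => k _.
  case: ifP => [/andP[kg ->]|_]; last first.
    case: ifP => // _; apply: sumr_ge0 => l _; rewrite !mulr_ge0 //.
    by apply: prodr_ge0 => i _; exact: level_weight_ge0.
  apply: (le_trans (ler_wpM2r (a0 k) (rho_le k kg))).
  rewrite mulr_suml; apply: ler_sum => l _.
  by rewrite big_split /= prod_ind mulrA.
(* With the sums exchanged, the inner one runs over the smaller box of shape [l], where [a_le]
   applies. *)
rewrite exchange_big /=.
apply: (@le_trans _ _
  (\sum_(l in family (fun i (j : 'I_G) => (j < (g i).+1)%N))
    \prod_i (level_weight R (p i) (l i) * (p i ^ l i)%N%:R ^+ 2))).
  apply: ler_sum => l /familyP lg; rewrite -mulr_sumr big_split /=.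
  apply: ler_wpM2l; first by apply: prodr_ge0 => i _; exact: level_weight_ge0.
  rewrite prodrXl -natr_prod; apply: le_trans (a_le (fun i => l i) _); last first.
    by move=> i; have := lg i; rewrite unfold_in ltnS.
  rewrite [leLHS]big_mkcond [leRHS]big_mkcond; apply: ler_sum => k _.
  by case: (box p _ k); case: (A k); rewrite ?mul1r ?mul0r.
rewrite -(@bigA_distr_big_dep _ _ _ _ _ _ _
  (fun i (j : 'I_G) => (j < (g i).+1)%N)
  (fun i (j : 'I_G) => level_weight R (p i) j * (p i ^ j)%N%:R ^+ 2)) /=.
rewrite le_eqVlt; apply/orP; left; apply/eqP; apply: eq_bigr => i _.
rewrite -(big_ord_widen G
  (fun j => level_weight R (p i) j * (p i ^ j)%N%:R ^+ 2)) //.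
by rewrite sum_level_weight // ltnW.
Qed.

(** * Total weight, and weight outside a box *)

Lemma sum_rho_box (R : realType) (s M : nat) (p : 'I_s -> nat) :
  (forall i, 1 < p i)%N ->
  \sum_(k : {ffun 'I_s -> 'I_M}) \prod_i rho R (p i) (k i) <= sigma R p.
Proof.
move=> p1; rewrite -(bigA_distr_bigA (fun i (j : 'I_M) => rho R (p i) j)).
apply: ler_prod => i _; rewrite sum_rho_le // andbT sumr_ge0 // => k _.
exact: rho_ge0.
Qed.

(** Union bound over the coordinate in which k leaves the box: there the factor p + 1 of sigma is
    replaced by the tail p / p^g, whence the quotient. *)
Lemma sum_rho_notin_box (R : realType) (s M : nat) (p g : 'I_s -> nat) :
  (forall i, 1 < p i)%N ->
  \sum_(k : {ffun 'I_s -> 'I_M} | ~~ box p g k) \prod_i rho R (p i) (k i) <=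
  sigma R p * \sum_i (p i)%:R / (p i)%:R ^+ g i / ((p i)%:R + 1).
Proof.
(* The product of [rho_ge i (k i) i'] over [i] is the weight of k if k leaves the box in coordinate
   [i'], and 0 otherwise. *)
move=> p1; pose rho_ge (i : 'I_s) (j : nat) (i' : 'I_s) : R :=
  if (i == i') && (j < p i ^ g i)%N then 0 else rho R (p i) j.
have rho_ge_ge0 i j i' : 0 <= rho_ge i j i'.
  by rewrite /rho_ge; case: ifP => // _; exact: rho_ge0.
apply: (@le_trans _ _
  (\sum_(k : {ffun 'I_s -> 'I_M}) \sum_i' \prod_i rho_ge i (k i) i')).
  rewrite [leLHS]big_mkcond; apply: ler_sum => k _; case: ifP => [kg|_].
    have [i' ki'] : exists i, ~~ (k i < p i ^ g i)%N.
      apply/existsP; rewrite -negb_forall; apply: contra kg => /forallP kg.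
      by apply/familyP => i; exact: kg.
    have -> : \prod_i rho R (p i) (k i) = \prod_i rho_ge i (k i) i'.
      apply: eq_bigr => i _; rewrite /rho_ge.
      by case: (eqVneq i i') => [->|//]; rewrite (negPf ki').
    rewrite [leRHS](bigD1 i') //= lerDl sumr_ge0 // => i _.
    exact: prodr_ge0.
  by apply: sumr_ge0 => i _; exact: prodr_ge0.
rewrite exchange_big mulr_sumr /=; apply: ler_sum => i' _.
rewrite -(bigA_distr_bigA (fun i (j : 'I_M) => rho_ge i j i')).
rewrite /sigma (bigD1 i') //= [X in _ <= X * _](bigD1 i') //=.
have p0 : 0 < (p i')%:R + 1 :> R by rewrite ltr_wpDl.
rewrite mulrC [leRHS]mulrC mulrA divfK ?gt_eqF // mulrC.
apply: ler_pM.
- by apply: sumr_ge0.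
- by apply: prodr_ge0 => i _; apply: sumr_ge0.
- rewrite (le_trans _ (sum_rho_ge R (g i') M (p1 i'))) //.
  rewrite [leRHS]big_mkcond /=; apply: ler_sum => k _.
  by rewrite /rho_ge eqxx /= ltnNge; case: (_ <= _)%N.
apply: ler_prod => i ii'; rewrite sumr_ge0 //=.
rewrite (le_trans _ (sum_rho_le R M (p1 i))) //; apply: ler_sum => k _.
by rewrite /rho_ge (negPf ii').
Qed.

(** * From the infinite series to finite truncations *)

(** The series is a supremum over finite sets of indices, each contained in some cube, which may be
    enlarged beyond any prescribed [M0]. *)
Lemma esum_ffun_le (R : realType) (s M0 : nat) (f : {ffun 'I_s -> nat} -> R)
    (B : R) :
  (forall k, 0 <= f k) ->
  (forall M, (M0 <= M)%N ->
    \sum_(k : {ffun 'I_s -> 'I_M.+1} | k != [ffun=> ord0])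
      f [ffun i => k i : nat] <= B) ->
  (\esum_(k in [set k : {ffun 'I_s -> nat} | k != [ffun=> 0%N]]) (f k)%:E
    <= B%:E)%E.
Proof.
move=> f0 f_le; apply: ge_ereal_sup => _ [A [finA A_neq0] <-].
rewrite fsbig_finite //= sumEFin lee_fin; set r := finmap.enum_fset _.
(* The sum of all coordinates occurring in the finite set dominates each of them. *)
pose M := (M0 + \sum_(k <- r) \sum_i k i)%N.
have rM k i : k \in r -> (k i < M.+1)%N.
  move=> kr; rewrite ltnS /M (big_rem k) //= (bigD1 i) //=; lia.
pose trunc (k : {ffun 'I_s -> nat}) : {ffun 'I_s -> 'I_M.+1} :=
  [ffun i => inord (k i)].
have truncK : {in r, cancel trunc (fun k => [ffun i => k i : nat])}.
  by move=> k kr; apply/ffunP => i; rewrite !ffunE inordK // rM.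
have r_neq0 k : k \in r -> k != [ffun=> 0%N].
  by move=> kr; apply: A_neq0; apply/set_mem; rewrite -(in_fset_set finA).
apply: le_trans (f_le M (leq_addr _ _)).
rewrite (_ : \sum_(k <- r) f k =
    \sum_(k <- map trunc r) f [ffun i => k i : nat]); last first.
  by rewrite big_map; apply: eq_big_seq => k kr; rewrite truncK.
rewrite big_uniq; last first.
  by rewrite map_inj_in_uniq ?finmap.fset_uniq //; exact: can_in_inj truncK.
rewrite [leLHS]big_mkcond [leRHS]big_mkcond; apply: ler_sum => k _.
case: ifP => [/mapP[k' k'r ->]|_]; last by case: ifP.
case: eqP => // trunc0; have := r_neq0 k' k'r.
rewrite -(truncK k' k'r) trunc0 => /eqP[].
by apply/ffunP => i; rewrite !ffunE.
Qed.

Lemma normc_ge0 (R : realType) (x : R[i]) : 0 <= Normc.normc x.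
Proof. by case: x => a b; exact: sqrtr_ge0. Qed.

(** * Truncated diaphony of the Halton sequence *)

Lemma sum_padic_fun_halton (R : realType) (s M : nat) (p : 'I_s -> nat)
    (N : nat) (k : {ffun 'I_s -> 'I_M}) :
  (forall i, 1 < p i)%N ->
  \sum_(0 <= n < N) padic_fun_vec p [ffun i => k i : nat] (halton R p n) =
  \sum_(n < N) echar_vec R p k ^+ n.
Proof.
move=> p1; rewrite big_mkord; apply: eq_bigr => n _.
rewrite /padic_fun_vec /echar_vec -prodrXl; apply: eq_bigr => i _.
by rewrite ffunE padic_fun_monna.
Qed.

Lemma normc_mean_echar_le1 (R : realType) (s M : nat) (p : 'I_s -> nat)
    (N : nat) (k : {ffun 'I_s -> 'I_M}) :
  Normc.normc (N%:R^-1 * \sum_(n < N) echar_vec R p k ^+ n) <= 1.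
Proof.
have norm1 : `|echar_vec R p k| = 1.
  rewrite /echar_vec normr_prod big1 // => i _.
  by rewrite [LHS](_ : _ = (Normc.normc (echar (monna R (p i) (k i))))%:C%C)
    // normc_echar.
rewrite -lecR rmorph1.
have -> : (Normc.normc (N%:R^-1 * \sum_(n < N) echar_vec R p k ^+ n))%:C%C =
  `|N%:R^-1 * \sum_(n < N) echar_vec R p k ^+ n| by [].
have [->|N0] := posnP N; first by rewrite big_ord0 mulr0 normr0.
rewrite normrM normfV normr_nat mulrC ler_pdivrMr ?ltr0n // mul1r.
apply: (le_trans (ler_norm_sum _ _ _)).
rewrite (eq_bigr (fun=> 1)) ?sumr_const ?card_ord // => n _.
by rewrite normrX norm1 expr1n.
Qed.

Lemma normc_natV_mul (R : realType) (N : nat) (x : R[i]) :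
  Normc.normc (N%:R^-1 * x) ^+ 2 = N%:R ^- 2 * Normc.normc x ^+ 2.
Proof.
rewrite Normc.normcM Normc.normcV exprMn exprVn; congr (_^-1 * _).
congr (_ ^+ 2); apply: complexI.
by rewrite rmorph_nat [LHS](_ : _ = `|N%:R|) // normr_nat.
Qed.

(** The truncation to a cube of the series for (sigma - 1) F_N^2, with the points already eliminated
    in favour of the powers of z_k. *)
Definition partial_diaphony (R : realType) (s M : nat) (p : 'I_s -> nat)
    (N : nat) : R :=
  \sum_(k : {ffun 'I_s -> 'I_M.+1} | k != [ffun=> ord0])
    (\prod_i rho R (p i) (k i)) *
    Normc.normc (N%:R^-1 * \sum_(n < N) echar_vec R p k ^+ n) ^+ 2.

(** Every mean has modulus at most 1, and the weight 1 of k = 0 is removed from the total weight. *)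
Lemma partial_diaphony_le_sigma (R : realType) (s M : nat) (p : 'I_s -> nat)
    (N : nat) :
  (forall i, 1 < p i)%N -> partial_diaphony R M p N <= sigma R p - 1.
Proof.
move=> p1; rewrite lerBrDl (le_trans _ (sum_rho_box R M.+1 p1)) //.
rewrite [leRHS](bigD1 [ffun=> ord0]) //= lerD //.
  by rewrite big1 // => i _; rewrite ffunE /rho eqxx.
apply: ler_sum => k _.
apply: ler_piMr; first by apply: prodr_ge0 => i _; exact: rho_ge0.
apply: exprn_ile1; last exact: normc_mean_echar_le1.
exact: normc_ge0.
Qed.

Lemma partial_diaphony_le (R : realType) (s M : nat) (p g : 'I_s -> nat)
    (N : nat) :
  (forall i, prime (p i)) -> injective p -> (forall i, p i ^ g i <= M.+1)%N ->
  partial_diaphony R M p N <=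
  N%:R ^- 2 * \prod_i (1 + (g i)%:R * (p i)%:R ^+ 2) +
  sigma R p * \sum_i (p i)%:R / (p i)%:R ^+ g i / ((p i)%:R + 1).
Proof.
move=> p_prime p_inj gM; have p1 i : (1 < p i)%N by rewrite prime_gt1.
rewrite /partial_diaphony (bigID (box p g)) /=; apply: lerD; last first.
  rewrite (le_trans _ (sum_rho_notin_box R M.+1 g p1)) //.
  rewrite [leLHS]big_mkcond [leRHS]big_mkcond; apply: ler_sum => k _.
  have rho0 : 0 <= \prod_i rho R (p i) (k i).
    by apply: prodr_ge0 => i _; exact: rho_ge0.
  case: (box p g k); rewrite ?andbF ?andbT //=; case: ifP => // _.
  apply: ler_piMr => //; apply: exprn_ile1; last exact: normc_mean_echar_le1.
  exact: normc_ge0.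
rewrite (eq_bigl (fun k => box p g k && (k != [ffun=> ord0]))); last first.
  by move=> k; rewrite andbC.
under eq_bigr => k _ do rewrite normc_natV_mul mulrCA.
rewrite -mulr_sumr; apply: ler_wpM2l; first by rewrite invr_ge0 exprn_ge0.
apply: sum_box_weighted => // [k|l lg]; first by rewrite sqr_ge0.
apply: sum_box_le => // i; apply: leq_trans (gM i).
by rewrite leq_exp2l.
Qed.

(** * Estimates for the chosen box *)

Lemma ln_nat_ge1 (R : realType) (N : nat) : (2 < N)%N -> 1 <= ln (N%:R : R).
Proof.
(* e = (e^(1/6))^6 <= (6/5)^6 < 3 *)
move=> N3; have e16 : expR (6^-1 : R) <= 6 / 5.
  (* Inverting 1 - 1/6 <= exp(-1/6) gives the bound 6/5. *)
  have := expR_ge1Dx (- 6^-1 : R); rewrite expRN.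
  have := expR_gt0 (6^-1 : R); set e := expR _ => e0.
  rewrite -(ler_pM2r e0) mulVf ?gt_eqF //; lra.
have e3 : expR (1 : R) <= 3.
  have -> : (1 : R) = 6%:R * 6^-1 by rewrite divff.
  rewrite expRM_natl (@le_trans _ _ ((6 / 5) ^+ 6)) //; last by lra.
  by rewrite lerXn2r // nnegrE ?expR_ge0 // divr_ge0.
rewrite -[leLHS]expRK ler_ln ?posrE ?expR_gt0 ?ltr0n 1?(ltn_trans _ N3) //.
by rewrite (le_trans e3) // ler_nat.
Qed.

(** From p^g <= N^2 follows g <= 2 ln N / ln p, and 1 <= ln N absorbs the leading 1. This produces
    the factors of [c_const]. *)
Lemma level_count_le (R : realType) (p N : nat) : (1 < p)%N -> (2 < N)%N ->
  1 + (trunc_log p (N ^ 2))%:R * p%:R ^+ 2 <=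
  ln N%:R * (1 + 2 * (p%:R ^+ 2 / ln p%:R)) :> R.
Proof.
move=> p1 N3; have lnN := ln_nat_ge1 R N3.
have lnp : 0 < ln p%:R :> R by rewrite ln_gt0 // ltr1n.
set g := trunc_log _ _.
have gle : g%:R * ln p%:R <= 2 * ln N%:R :> R.
  rewrite !mulr_natl -!lnXn ?ltr0n 1?ltnW //; last exact: ltn_trans N3.
  rewrite ler_ln ?posrE ?exprn_gt0 ?ltr0n 1?ltnW //; last exact: ltn_trans N3.
  by rewrite -!natrX ler_nat trunc_logP // expn_gt0 (ltn_trans _ N3).
have -> : g%:R = (g%:R * ln p%:R) / ln p%:R :> R by rewrite mulfK // gt_eqF.
rewrite mulrDr mulr1 lerD //.
have -> : ln N%:R * (2 * (p%:R ^+ 2 / ln p%:R)) =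
  (2 * ln N%:R) / ln p%:R * p%:R ^+ 2 :> R by ring.
by rewrite ler_wpM2r ?exprn_ge0 // ler_wpM2r // invr_ge0 ltW.
Qed.

(** Maximality of g gives N^2 < p^(g+1) = p^g p <= p^g (p + 1). *)
Lemma tail_le (R : realType) (p N : nat) : (1 < p)%N -> (0 < N)%N ->
  p%:R / p%:R ^+ trunc_log p (N ^ 2) / (p%:R + 1) <= p%:R / N%:R ^+ 2 :> R.
Proof.
move=> p1 N0; set g := trunc_log _ _.
have p0 : 0 < p%:R :> R by rewrite ltr0n ltnW.
have N2 : 0 < N%:R ^+ 2 :> R by rewrite exprn_gt0 ?ltr0n.
have pg0 : 0 < p%:R ^+ g :> R by rewrite exprn_gt0.
have Nlt : N%:R ^+ 2 <= p%:R ^+ g * p%:R :> R.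
  by rewrite -!natrX -natrM -expnSr ler_nat ltnW // trunc_log_ltn.
rewrite -!mulrA ler_pM2l // -invfM.
rewrite lef_pV2 ?posrE //; last by rewrite mulr_gt0 // addr_gt0.
by rewrite (le_trans Nlt) // ler_pM2l // lerDl.
Qed.

(** * Explicit constants and the final bound *)

(** Besides making sigma - 1 positive, the bound 2 yields sigma <= 2 (sigma - 1), the source of the
    factor 2 in [d_const]. *)
Lemma sigma_ge2 (R : realType) (s : nat) (p : 'I_s -> nat) :
  (0 < s)%N -> (forall i, 1 < p i)%N -> 2 <= sigma R p.
Proof.
move=> s0 p1; rewrite /sigma (bigD1 (Ordinal s0)) //= -[leLHS]mulr1.
apply: ler_pM => //; first by rewrite -[2]/(1 + 1) lerD ?ler1n 1?ltnW.
rewrite (@le_trans _ _ (\prod_(i < s | i != Ordinal s0) 1)) //.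
  by rewrite big1.
by apply: ler_prod => i _; rewrite ler01 /= lerDr.
Qed.

Lemma partial_diaphony_bound (R : realType) (s M : nat) (p : 'I_s -> nat)
    (N : nat) :
  (0 < s)%N -> (forall i, prime (p i)) -> injective p -> (0 < N)%N ->
  (N ^ 2 <= M)%N ->
  partial_diaphony R M p N <= (sigma R p - 1) *
    (c_const R p * (ln N%:R ^+ s / N%:R ^+ 2) + d_const R p / N%:R ^+ 2).
Proof.
move=> s0 p_prime p_inj N0 NM; have p1 i : (1 < p i)%N by rewrite prime_gt1.
have s2 := sigma_ge2 R s0 p1; have s1 : 0 < sigma R p - 1 by lra.
have N2 : 0 < N%:R ^+ 2 :> R by rewrite exprn_gt0 ?ltr0n.
have lnN0 : 0 <= ln N%:R :> R by rewrite ln_ge0 // ler1n.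
(* Of the factor pi^2 / 3 only this lower bound is used; pi >= 2 suffices, since 4/3 >= 1. *)
have pi3 : 1 <= pi ^+ 2 / 3 :> R by have := pi_ge2 R; nra.
pose Q : R := \prod_j (1 + 2 * ((p j)%:R ^+ 2 / ln (p j)%:R)).
have Q0 : 0 <= Q.
  apply: prodr_ge0 => j _; rewrite addr_ge0 // mulr_ge0 // divr_ge0 //.
  by rewrite ln_ge0 // ler1n ltnW.
have c_eq : (sigma R p - 1) * (c_const R p * (ln N%:R ^+ s / N%:R ^+ 2)) =
    pi ^+ 2 / 3 * (N%:R ^- 2 * (ln N%:R ^+ s * Q)).
  by rewrite /c_const -/Q; field; rewrite pnatr_eq0 -lt0n N0 gt_eqF.
(* For N <= 2, ln N < 1 and the logarithmic term is useless, but the diaphony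
   is at most 1 and the second term is at least 1. *)
rewrite mulrDr c_eq; case: (leqP N 2) => [Nle2|N3].
  apply: (le_trans (partial_diaphony_le_sigma R M N p1)).
  rewrite -[leLHS]mulr1 -[leLHS]add0r; apply: lerD.
    by rewrite !mulr_ge0 ?invr_ge0 ?exprn_ge0 ?pi_ge0 //; lra.
  rewrite ler_pM2l // ler_pdivlMr // mul1r -natrX /d_const ler_nat.
  (* N^2 <= 4 = 2 * 1 * 2 <= 2 s max p_i, since s >= 1 and some prime is at least 2. *)
  rewrite (@leq_trans (2 ^ 2)) ?leq_exp2r //.
  rewrite -[(2 ^ 2)%N]/(2 * 1 * 2)%N leq_mul ?leq_mul //.
  exact: leq_trans (p1 (Ordinal s0)) (leq_bigmax _).
pose g i := trunc_log (p i) (N ^ 2).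
have gM i : (p i ^ g i <= M.+1)%N.
  by rewrite (leq_trans (trunc_logP _ _)) ?(leq_trans NM) // expn_gt0 N0.
apply: (le_trans (partial_diaphony_le R N p_prime p_inj gM)); apply: lerD.
  apply: (@le_trans _ _ (N%:R ^- 2 * (ln N%:R ^+ s * Q))); last first.
    by rewrite ler_peMl // !mulr_ge0 ?invr_ge0 ?exprn_ge0.
  rewrite ler_wpM2l ?invr_ge0 ?exprn_ge0 //.
  rewrite -[X in _ ^+ X]card_ord -prodr_const -big_split /=.
  apply: ler_prod => i _; rewrite level_count_le // andbT.
  by rewrite addr_ge0 // mulr_ge0 // exprn_ge0.
pose m := \max_i p i.
have tail : \sum_i (p i)%:R / (p i)%:R ^+ g i / ((p i)%:R + 1) <=
    (s * m)%:R / N%:R ^+ 2 :> R.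
  rewrite (@le_trans _ _ (\sum_(i < s) m%:R / N%:R ^+ 2)) //.
    apply: ler_sum => i _; rewrite (le_trans (tail_le R (p1 i) N0)) //.
    by rewrite ler_pM2r ?invr_gt0 // ler_nat leq_bigmax.
  by rewrite sumr_const card_ord mulnC mulrnA -[leLHS]mulrnAl.
apply: (le_trans (ler_wpM2l _ tail)); first by lra.
(* After cancelling N^2 and s max p_i, what remains is sigma <= 2 (sigma - 1). *)
rewrite /d_const -mulnA -/m !mulrA ler_pM2r ?invr_gt0 // [in leRHS]natrM mulrA.
by apply: ler_wpM2r => //; lra.
Qed.

Theorem theorem1 (R : realType) (s : nat) (p : 'I_s -> nat)
    (s_gt0 : (0 < s)%N) (p_prime : forall i, prime (p i))
    (p_inj : injective p) (N : nat) (N_gt0 : (0 < N)%N) :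
  (diaphony p (halton R p) N ^+ 2 <=
   (c_const R p * (ln N%:R ^+ s / N%:R ^+ 2) + d_const R p / N%:R ^+ 2)%:E)%E.
Proof.
have p1 i : (1 < p i)%N by rewrite prime_gt1.
have s1 : 0 < sigma R p - 1 by have := sigma_ge2 R s_gt0 p1; lra.
have term_ge0 (k : {ffun 'I_s -> nat}) :
    0 <= rho_vec R p k * Normc.normc (N%:R^-1 *
      \sum_(0 <= n < N) padic_fun_vec p k (halton R p n)) ^+ 2.
  by rewrite mulr_ge0 ?sqr_ge0 // prodr_ge0 // => i _; exact: rho_ge0.
rewrite /diaphony sqr_sqrte; last first.
  apply: mule_ge0; first by rewrite lee_fin invr_ge0 ltW.
  by apply: esum_ge0 => k _; rewrite lee_fin.
rewrite lee_pdivrMl // -EFinM.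
(* Cubes with M >= N^2 contain the box chosen by p_i^(g_i) <= N^2. *)
apply: (@esum_ffun_le _ _ (N ^ 2) _ _ term_ge0) => M NM.
apply: le_trans (partial_diaphony_bound R s_gt0 p_prime p_inj N_gt0 NM).
rewrite le_eqVlt; apply/orP; left; apply/eqP; apply: eq_bigr => k _.
rewrite sum_padic_fun_halton // /rho_vec; congr (_ * _).
by apply: eq_bigr => i _; rewrite ffunE.
Qed.
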